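(* Let $\mathbb{K}$ be a field, $R=\mathbb{K}[x_1,x_2,x_3]$ (the case $n=3$), and let $\phi:\{1,2,3\}\to\mathbb{N}$ be a linear or an almost linear degree function. Suppose that $\operatorname{char}(\mathbb{K})=0$ or $\operatorname{char}(\mathbb{K})>\phi(1)+\phi(2)+\phi(3)-2$. Then the Hilbert series of $R/I_\phi$ and $R/J_\phi$ coincide: $P(R/I_\phi,t)=P(R/J_\phi,t)$.
   Context: $\mathbb{N}$ denotes the positive integers. A function $\phi:\{1,2,3\}\to\mathbb{N}$ is a linear degree function if there are $k,l\in\mathbb{N}$ with $\phi(r)=l+k(3-r)$ for $r=1,2,3$. It is an almost linear degree function if there is $k\in\mathbb{N}$ such that $\phi(r)-\phi(r+1)\in\{k,k+1\}$ for $r=1,2$. For such $\phi$, define the following homogeneous ideals of $R=\mathbb{K}[x_1,x_2,x_3]$: $$I_\phi=\langle x_1^{\phi(1)},x_2^{\phi(1)},x_3^{\phi(1)},(x_1x_2)^{\phi(2)},(x_1x_3)^{\phi(2)},(x_2x_3)^{\phi(2)},(x_1x_2x_3)^{\phi(3)}\rangle,$$ $$J_\phi=\langle x_1^{\phi(1)},x_2^{\phi(1)},x_3^{\phi(1)},(x_1+x_2)^{2\phi(2)},(x_1+x_3)^{2\phi(2)},(x_2+x_3)^{2\phi(2)},(x_1+x_2+x_3)^{3\phi(3)}\rangle.$$ For a homogeneous ideal $I\subseteq R$ (standard grading), $P(R/I,t)=\sum_{j\ge 0}\dim_{\mathbb{K}}(R/I)_j\,t^j$. *)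

(* Defs.v *)
From Stdlib Require Import ClassicalEpsilon.
From mathcomp Require Import all_boot all_order all_algebra.
From mathcomp Require Export mpoly.

Set Implicit Arguments.
Unset Strict Implicit.
Unset Printing Implicit Defensive.

Import GRing.Theory.
Local Open Scope ring_scope.

(* A degree function is a map {1,2,3} -> {1,2,...}.  It is encoded as a map
   nat -> nat whose values outside {1,2,3} are irrelevant. *)
Definition degree_function (phi : nat -> nat) : Prop :=
  forall r, (1 <= r <= 3)%N -> (0 < phi r)%N.

Definition linear_degree_function (phi : nat -> nat) : Prop :=
  degree_function phi /\
  exists k l : nat, [/\ (0 < k)%N, (0 < l)%N &
    forall r, (1 <= r <= 3)%N -> phi r = (l + k * (3 - r))%N].

Definition almost_linear_degree_function (phi : nat -> nat) : Prop :=
  degree_function phi /\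
  exists2 k : nat, (0 < k)%N &
    forall r, (1 <= r <= 2)%N ->
      (phi r)%:Z - (phi r.+1)%:Z = k%:Z \/
      (phi r)%:Z - (phi r.+1)%:Z = k.+1%:Z.

Definition ideal_gen (A : comNzRingType) (gs : seq A) (p : A) : Prop :=
  exists c : nat -> A, p = \sum_(i < size gs) c i * gs`_i.

Section Generators.
Variables (K : fieldType) (phi : nat -> nat).

Let x1 : {mpoly K[3]} := 'X_(@Ordinal 3 0 isT).
Let x2 : {mpoly K[3]} := 'X_(@Ordinal 3 1 isT).
Let x3 : {mpoly K[3]} := 'X_(@Ordinal 3 2 isT).

Definition I_ideal : {mpoly K[3]} -> Prop := ideal_gen
  [:: x1 ^+ phi 1%N; x2 ^+ phi 1%N; x3 ^+ phi 1%N;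
      (x1 * x2) ^+ phi 2%N; (x1 * x3) ^+ phi 2%N; (x2 * x3) ^+ phi 2%N;
      (x1 * x2 * x3) ^+ phi 3%N].

Definition J_ideal : {mpoly K[3]} -> Prop := ideal_gen
  [:: x1 ^+ phi 1%N; x2 ^+ phi 1%N; x3 ^+ phi 1%N;
      (x1 + x2) ^+ (2 * phi 2%N); (x1 + x3) ^+ (2 * phi 2%N);
      (x2 + x3) ^+ (2 * phi 2%N);
      (x1 + x2 + x3) ^+ (3 * phi 3%N)].

End Generators.
Arguments I_ideal : clear implicits.
Arguments J_ideal : clear implicits.

Section HilbertSeries.
Variables (K : fieldType) (n : nat) (I : {mpoly K[n.+1]} -> Prop) (j : nat).

(* The classes modulo I of the forms b_0, ..., b_(d-1) of degree j are a
   K-basis of (R/I)_j, the image in R/I of the space R_j = dhomog n.+1 K j of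
   forms of degree j. *)
Definition quotient_basis (d : nat) (b : 'I_d -> dhomog n.+1 K j) : Prop :=
  (forall c : 'I_d -> K,
     I (\sum_(i < d) c i *: mpoly_of_dhomog (b i)) -> forall i, c i = 0) /\
  (forall p : dhomog n.+1 K j, exists c : 'I_d -> K,
     I (mpoly_of_dhomog p - \sum_(i < d) c i *: mpoly_of_dhomog (b i))).

Definition quotient_dim (d : nat) : Prop :=
  exists b : 'I_d -> dhomog n.+1 K j, quotient_basis b.

(* The j-th coefficient of P(R/I,t); hilbert_series_spec and
   hilbert_series_unique show that epsilon picks the dimension of (R/I)_j. *)
Definition hilbert_series : nat := epsilon (inhabits 0%N) quotient_dim.

End HilbertSeries.

Section IdealGen.
Variables (K : fieldType) (n : nat) (gs : seq {mpoly K[n]}).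

Lemma ideal_gen0 : ideal_gen gs 0.
Proof. by exists (fun=> 0); rewrite big1 // => i _; rewrite mul0r. Qed.

Lemma ideal_genD p q : ideal_gen gs p -> ideal_gen gs q -> ideal_gen gs (p + q).
Proof.
move=> [c ->] [e ->]; exists (fun i => c i + e i).
by rewrite -big_split; apply: eq_bigr => i _; rewrite mulrDl.
Qed.

Lemma ideal_genZ a p : ideal_gen gs p -> ideal_gen gs (a *: p).
Proof.
move=> [c ->]; exists (fun i => a *: c i).
by rewrite scaler_sumr; apply: eq_bigr => i _; rewrite scalerAl.
Qed.

End IdealGen.

Section WellDefined.
Variables (K : fieldType) (n : nat) (I : {mpoly K[n.+1]} -> Prop) (j : nat).
Hypothesis I0 : I 0.
Hypothesis ID : forall p q, I p -> I q -> I (p + q).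
Hypothesis IZ : forall a p, I p -> I (a *: p).

Let I_sum d (F : 'I_d -> {mpoly K[n.+1]}) :
  (forall i, I (F i)) -> I (\sum_(i < d) F i).
Proof. by move=> IF; apply: (big_ind I). Qed.

Lemma quotient_dim_le d e (b : 'I_d -> dhomog n.+1 K j)
    (b' : 'I_e -> dhomog n.+1 K j) :
  quotient_basis I b -> quotient_basis I b' -> (d <= e)%N.
Proof.
move=> [freeb _] [_ genb']; rewrite leqNgt; apply/negP => lt_ed.
have /fin_all_exists [A AP] i := genb' (b i).
pose M : 'M[K]_(d, e) := \matrix_(i, k) A i k.
have nzker : kermx M != 0.
  rewrite -mxrank_eq0 mxrank_ker subn_eq0 -ltnNge.
  exact: leq_ltn_trans (rank_leq_col M) lt_ed.
have /rowV0Pn [v /sub_kermxP vM nzv] := nzker.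
move/negP: nzv; apply; apply/eqP/rowP => i; rewrite mxE.
apply: (freeb (fun i => v 0 i)).
have -> : \sum_(i < d) v 0 i *: mpoly_of_dhomog (b i) =
    \sum_(i < d) v 0 i *: (mpoly_of_dhomog (b i) -
       \sum_(k < e) A i k *: mpoly_of_dhomog (b' k)).
  under [RHS]eq_bigr => k _ do rewrite scalerBr.
  rewrite sumrB; set S := (X in _ = _ - X); suff -> : S = 0 by rewrite subr0.
  rewrite /S; under eq_bigr => k _ do rewrite scaler_sumr.
  rewrite exchange_big big1 //= => k _.
  under eq_bigr => l _ do rewrite scalerA.
  rewrite -scaler_suml; have /rowP/(_ k) := vM; rewrite !mxE => vMk.
  rewrite (_ : \sum_(l < d) _ = 0) ?scale0r // -[RHS]vMk.
  by apply: eq_bigr => l _; rewrite mxE.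
by apply: I_sum => k; apply: IZ.
Qed.

Lemma quotient_dim_unique d e :
  quotient_dim I j d -> quotient_dim I j e -> d = e.
Proof.
move=> [b Hb] [b' Hb']; apply/eqP; rewrite eqn_leq.
by rewrite (quotient_dim_le Hb Hb') (quotient_dim_le Hb' Hb).
Qed.

Let qfree d (b : 'I_d -> dhomog n.+1 K j) := forall c : 'I_d -> K,
  I (\sum_(i < d) c i *: mpoly_of_dhomog (b i)) -> forall i, c i = 0.

Let qfree_le d (b : 'I_d -> dhomog n.+1 K j) :
  qfree b -> (d <= dim (dhomog n.+1 K j))%N.
Proof.
move=> fb; have : free [tuple b i | i < d].
  apply/freeP => c c0; apply: fb.
  have -> : \sum_(i < d) c i *: mpoly_of_dhomog (b i) =
      mpoly_of_dhomog (\sum_(i < d) c i *: [tuple b i | i < d]`_i).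
    rewrite raddf_sum; apply: eq_bigr => i _.
    by rewrite -tnth_nth tnth_mktuple.
  by rewrite c0 raddf0.
rewrite /free size_tuple => /eqP <-.
by rewrite -dimvf; apply/dimvS/subvf.
Qed.

Lemma quotient_dim_exists : exists d, quotient_dim I j d.
Proof.
have step m : (exists d, quotient_dim I j d) \/
    exists b : 'I_m -> dhomog n.+1 K j, qfree b.
  elim: m => [|m [?|[b fb]]]; first by right; exists (fun=> 0) => c _ [].
    by left.
  have [genb|] := classic (forall p : dhomog n.+1 K j, exists c : 'I_m -> K,
      I (mpoly_of_dhomog p - \sum_(i < m) c i *: mpoly_of_dhomog (b i))).
    by left; exists m, b; split.
  move/not_all_ex_not => [p Np]; right.
  exists (fun i => if unlift ord0 i is Some k then b k else p) => c.
  rewrite big_ord_recl unlift_none.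
  under eq_bigr => k _ do rewrite liftK.
  move=> Ic; have c0 : c ord0 = 0.
    apply/eqP/negPn/negP => nz; apply: Np.
    exists (fun k => - ((c ord0)^-1 * c (lift ord0 k))).
    have := IZ (c ord0)^-1 Ic; rewrite scalerDr scalerA mulVf // scale1r.
    rewrite scaler_sumr -sumrN; congr (I (_ + _)); apply: eq_bigr => k _.
    by rewrite scaleNr opprK scalerA.
  move: Ic; rewrite c0 scale0r add0r => /fb cS i.
  by case: (unliftP ord0 i) => [k|] ->.
have [//|[b /qfree_le]] := step (dim (dhomog n.+1 K j)).+1.
by rewrite ltnn.
Qed.

Lemma hilbert_series_spec : quotient_dim I j (hilbert_series I j).
Proof. by apply: epsilon_spec; apply: quotient_dim_exists. Qed.

Lemma hilbert_series_unique d : quotient_dim I j d -> hilbert_series I j = d.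
Proof. exact/quotient_dim_unique/hilbert_series_spec. Qed.

End WellDefined.

(* Main.v *)
Require Import Defs.
From mathcomp Require Import all_boot all_order all_algebra.
From mathcomp Require Import ssrcomplements zify ring.

(** Write a >= b >= c for the three values of the degree function and
    D = a + b + c - 2.  A monomial is standard if it lies outside the monomial
    ideal I: all its exponents are < a, at most one is >= b, and not all three
    are >= c.  The standard monomials of degree j form a basis of (R/I)_j, and
    none has degree >= D.  It has to be shown that their number is also the
    dimension of (R/J)_j, for every j.  For a set S of variables let l_S be
    their sum; J is generated by the powers of the seven forms l_S with exponent
    |S| phi(|S|).

    Upper bound.  A monomial whose exponents on S are all >= e is congruent
    modulo l_S^(|S| e) to a combination of monomials that have some exponent < e
    on S and the same exponents outside S ([straighten_monomial]).  The reason
    is that the map g |-> d (l_S^(|S| e) g), where d differentiates e times in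
    each variable of S, is triangular for the filtration by powers of l_S, with
    quotients of factorials on the diagonal; these are nonzero because the
    degrees do not exceed the bound on the characteristic.  Straightening the
    largest S first and then smaller and smaller S rewrites every monomial of
    degree <= D into standard ones ([spanned_mod_standard]).  In degree D there
    are no standard monomials, so J contains every form of degree >= D.

    Lower bound.  For the pairing f, F |-> f(d/dx) F (0), multiplication by l_S
    is adjoint to the derivation d_S, the sum of the partial derivatives along
    S, so a form F with d_S^(|S| phi(|S|)) F = 0 for all S is orthogonal to J.
    Geometrically, F is a curve of degree j with prescribed multiplicities at
    the seven points (1:0:0), (1:1:0), (1:1:1), and so on; these points lie by
    threes on the six lines X_i = 0 and X_i = X_k.  When j is large, Bezout's
    theorem forces the lines to be components of F.  Hence one takes
    F = (X0 X1 X2)^n1 ((X0-X1)(X0-X2)(X1-X2))^n2 G; by the Leibniz rule it is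
    enough that d_S^(e_S) G = 0 for smaller exponents e_S, and these conditions
    on G are merely counted ([leq_hilbert_power_ideal]).

    The two bounds meet.  Inclusion and exclusion ([count_I_standard]) gives the
    number of standard monomials, and for the right n1 and n2 the count of
    conditions yields the same number ([line_multiplicities]).  This is where
    the degree function has to be linear or almost linear.  Inclusion and
    exclusion puts two correction terms on each line: both in degree a + b on
    the lines X_i = 0, in degrees a + 2c and 2b + c on the lines X_i = X_k.
    Removing a line as often as Bezout's theorem asks recovers exactly such a
    pair of terms if its two degrees are equal or differ by one. *)

Set Implicit Arguments.
Unset Strict Implicit.
Unset Printing Implicit Defensive.

Import GRing.Theory.
Local Open Scope ring_scope.

(** * Linear algebra: two ways to compare dimensions *)

Lemma leq_of_free_matrix (K : fieldType) d e (A : 'I_d -> 'I_e -> K) :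
  (forall c : 'I_d -> K, (forall k, \sum_i c i * A i k = 0) ->
     forall i, c i = 0) -> (d <= e)%N.
Proof.
move=> freeA; rewrite leqNgt; apply/negP => lt_ed.
pose M : 'M[K]_(d, e) := \matrix_(i, k) A i k.
have : kermx M != 0.
  rewrite -mxrank_eq0 mxrank_ker subn_eq0 -ltnNge.
  exact: leq_ltn_trans (rank_leq_col M) lt_ed.
case/rowV0Pn => v /sub_kermxP vM /negP[]; apply/eqP/rowP => i; rewrite mxE.
apply: (freeA (v 0)) => k; have /rowP/(_ k) := vM; rewrite !mxE => vMk.
by rewrite -[RHS]vMk; apply: eq_bigr => l _; rewrite mxE.
Qed.

(** The form in which the lower bound uses linear algebra: [s] consists of
    monomials, and [ts] indexes conditions that only the zero form satisfies. *)
Lemma leq_of_separating (K : fieldType) (V : lmodType K) (s : seq V)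
    (T : eqType) (ts : seq T) (phi : T -> V -> K) :
    (forall t, scalar (phi t)) ->
    (forall c : 'I_(size s) -> K,
       {in ts, forall t, phi t (\sum_i c i *: s`_i) = 0} ->
       forall i, c i = 0) ->
  (size s <= size ts)%N.
Proof.
move=> lin sep; apply: (@leq_of_free_matrix K _ _
  (fun i k => phi (tnth (in_tuple ts) k) s`_i)) => c c0.
apply: sep => t /(@tnthP _ _ (in_tuple ts))[k ->]; rewrite -[RHS](c0 k).
set f := phi _; have f0 : f 0 = 0.
  have := lin (tnth (in_tuple ts) k) (-1) 0 0.
  by rewrite scaler0 addr0 mulN1r addNr.
elim/big_rec2: _ => // i x y _ <-; exact: lin.
Qed.

(** * Ideals, and the Hilbert series of a monomial ideal *)

Section IdealGen.
Variables (A : comNzRingType) (gs : seq A).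

Lemma ideal_gen_mem g : g \in gs -> ideal_gen gs g.
Proof.
move=> gs_g; have lt_g : (index g gs < size gs)%N by rewrite index_mem.
exists (fun i => (i == index g gs)%:R).
rewrite (bigD1 (Ordinal lt_g)) //= eqxx mul1r nth_index // big1 ?addr0 // => i.
by rewrite -val_eqE /= => /negbTE ->; rewrite mul0r.
Qed.

Lemma ideal_genMl p q : ideal_gen gs q -> ideal_gen gs (p * q).
Proof.
move=> [c ->]; exists (fun i => p * c i).
by rewrite mulr_sumr; apply: eq_bigr => i _; rewrite mulrA.
Qed.

Lemma ideal_gen_ind (P : A -> Prop) :
    P 0 -> (forall p q, P p -> P q -> P (p + q)) ->
    (forall g p, g \in gs -> P (p * g)) ->
  forall p, ideal_gen gs p -> P p.
Proof.
move=> P0 PD PM p [c ->]; apply: (big_ind P) => // i _.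
by apply/PM/mem_nth.
Qed.

End IdealGen.

Definition monomials n d : seq 'X_{1..n} :=
  [seq s2m t | t : d.-tuple 'I_n <- enum (basis n d)].

Section Monomials.
Variables (n : nat).
Implicit Types m : 'X_{1..n.+1}.

Lemma mem_monomials d m : (m \in monomials n.+1 d) = (mdeg m == d).
Proof. by rewrite /monomials -basis_cover. Qed.

Lemma uniq_monomials d : uniq (monomials n.+1 d).
Proof. exact: uniq_basis. Qed.

End Monomials.

Section MonomialIdeal.
Variables (K : fieldType) (n : nat).
Implicit Types (m g : 'X_{1..n}) (p q : {mpoly K[n]}).

Lemma ideal_gen_monomialP (ms : seq 'X_{1..n}) p :
  ideal_gen [seq 'X_[g] : {mpoly K[n]} | g <- ms] p <->
  {in msupp p, forall m, has (fun g => (g <= m)%MM) ms}.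
Proof.
split=> [|supp_p].
  move: p; apply: ideal_gen_ind.
  - by move=> m; rewrite msupp0.
  - by move=> p q Pp Pq m /msuppD_le; rewrite mem_cat => /orP[/Pp|/Pq].
  - move=> _ p /mapP[g ms_g ->] m.
    rewrite (perm_mem (msuppMX _ _)) => /mapP[m' _ ->].
    by apply/hasP; exists g => //; apply: lem_addr.
rewrite [p]mpolyE big_seq; apply: (big_ind (ideal_gen _)).
- exact: ideal_gen0.
- exact: ideal_genD.
move=> m /supp_p/hasP[g ms_g le_gm]; apply: ideal_genZ.
by rewrite -(submK le_gm) mpolyXD; apply/ideal_genMl/ideal_gen_mem/map_f.
Qed.

End MonomialIdeal.

Section HilbertMonomial.
Variables (K : fieldType) (n : nat).

Lemma hilbert_monomial_ideal (ms : seq 'X_{1..n.+1}) d :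
  hilbert_series (ideal_gen [seq 'X_[g] : {mpoly K[n.+1]} | g <- ms]) d =
  count (fun m => ~~ has (fun g => (g <= m)%MM) ms) (monomials n.+1 d).
Proof.
set std := fun m : 'X_{1..n.+1} => ~~ _.
set s := [seq m <- monomials n.+1 d | std m].
have mem_s m : m \in s = std m && (mdeg m == d).
  by rewrite mem_filter mem_monomials.
have uniq_s : uniq s by rewrite filter_uniq ?uniq_monomials.
rewrite -size_filter -/s.
apply: hilbert_series_unique.
- exact: ideal_gen0.
- exact: ideal_genD.
- exact: ideal_genZ.
have hom_s (i : 'I_(size s)) :
    ('X_[nth 0%MM s i] : {mpoly K[n.+1]}) \is d.-homog.
  rewrite dhomogX; have := mem_nth 0%MM (ltn_ord i).
  by rewrite mem_s => /andP[].
exists (fun i => DHomog (hom_s i)); split=> /=.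
  move=> c /ideal_gen_monomialP cI i; apply/eqP/negPn/negP => nz_ci.
  have /cI : nth 0%MM s i \in msupp (\sum_i c i *: 'X_[nth 0%MM s i]).
    rewrite mcoeff_msupp linear_sum (bigD1 i) //= mcoeffZ mcoeffX eqxx mulr1.
    rewrite big1 ?addr0 // => k ne_ki; rewrite mcoeffZ mcoeffX nth_uniq //.
    by rewrite -val_eqE in ne_ki; rewrite (negbTE ne_ki) mulr0.
  apply/negP; have := mem_nth 0%MM (ltn_ord i); rewrite mem_s.
  by case/andP.
move=> p; exists (fun i => (val p)@_(nth 0%MM s i)).
apply/ideal_gen_monomialP => m; rewrite mcoeff_msupp; apply: contraR => Nm.
have -> : \sum_(i < size s) (val p)@_(nth 0%MM s i) *: 'X_[nth 0%MM s i] =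
    \sum_(m <- s) (val p)@_m *: 'X_[m] :> {mpoly K[n.+1]}.
  by rewrite (big_nth 0%MM) big_mkord.
rewrite mcoeffB linear_sum /=; have [dm|ndm] := eqVneq (mdeg m) d.
  have sm : m \in s by rewrite mem_s dm eqxx andbT.
  rewrite (bigD1_seq m) //= mcoeffZ mcoeffX eqxx mulr1 big1 ?addr0 ?subrr //.
  by move=> m' ne; rewrite mcoeffZ mcoeffX (negbTE ne) mulr0.
rewrite (dhomog_nemf_coeff (dhomog_is_dhomog p) ndm) big_seq big1 ?subrr //.
move=> m'; rewrite mem_s mcoeffZ mcoeffX => /andP[_ dm'].
by case: (m' =P m) dm' ndm => [->->|] //; rewrite mulr0.
Qed.

End HilbertMonomial.

(** * Straightening modulo powers of sums of variables *)

Definition natr_unit_upto (K : fieldType) (B : nat) :=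
  forall k, (0 < k <= B)%N -> k%:R != 0 :> K.

Lemma natr_unit_uptoS (K : fieldType) B B' :
  (B <= B')%N -> natr_unit_upto K B' -> natr_unit_upto K B.
Proof.
by move=> le_B u k /andP[k0 le_k]; apply: u; rewrite k0 (leq_trans le_k).
Qed.

Lemma natr_ffact_neq0 (K : fieldType) B n m :
  natr_unit_upto K B -> (m <= n <= B)%N -> (n ^_ m)%:R != 0 :> K.
Proof.
move=> unitB /andP[le_mn le_nB]; rewrite ffact_prod natr_prod prodf_seq_neq0.
apply/allP => i _; apply: unitB; have := ltn_ord i; lia.
Qed.

Lemma deriv_var (K : fieldType) n (i j : 'I_n) :
  ('X_i : {mpoly K[n]})^`M(j) = (i == j)%:R%:MP.
Proof.
rewrite mderivX mnm1E; case: eqP => [->|_]; last by rewrite scale0r.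
rewrite scale1r; have -> : (U_(j) - U_(j) = 0)%MM.
  by apply/mnmP => k; rewrite mnmBE subnn mnm0E.
by rewrite mpolyX0.
Qed.

Section Straightening.
Variables (K : fieldType) (n : nat) (S : {set 'I_n}).
Implicit Types (m : 'X_{1..n}) (p q h g : {mpoly K[n]}) (s : nat).

Definition linear_sum_on : {mpoly K[n]} := \sum_(i in S) 'X_i.
Local Notation l := linear_sum_on.

(** [m0] records the exponents outside S, which straightening leaves unchanged;
    s is the degree in the variables of S. *)
Definition form_on m0 s p := {in msupp p, forall m,
  (forall i, i \notin S -> m i = m0 i) /\ (\sum_(i in S) m i = s)%N}.

Lemma form_on0 m0 s : form_on m0 s 0.
Proof. by move=> m; rewrite msupp0. Qed.

Lemma form_onD m0 s p q :
  form_on m0 s p -> form_on m0 s q -> form_on m0 s (p + q).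
Proof.
by move=> Fp Fq m /msuppD_le; rewrite mem_cat => /orP[/Fp|/Fq].
Qed.

Lemma form_onZ m0 s a p : form_on m0 s p -> form_on m0 s (a *: p).
Proof. by move=> Fp m /msuppZ_le/Fp. Qed.

Lemma form_onB m0 s p q :
  form_on m0 s p -> form_on m0 s q -> form_on m0 s (p - q).
Proof. by move=> Fp Fq; rewrite -scaleN1r; apply/form_onD/form_onZ. Qed.

Lemma sum_on_mnmD m i :
  i \in S -> (\sum_(j in S) (m + U_(i))%MM j = (\sum_(j in S) m j).+1)%N.
Proof.
move=> Si; under eq_bigr => j _ do rewrite mnmDE mnm1E.
rewrite big_split /= -addn1; congr addn.
rewrite (bigD1 i) //= eqxx big1 // => j /andP[_ /negbTE].
by rewrite eq_sym => ->.
Qed.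

Lemma form_on_mulX m0 s i p :
  i \in S -> form_on m0 s p -> form_on m0 s.+1 ('X_i * p).
Proof.
move=> Si Fp m; rewrite mulrC (perm_mem (msuppMX _ _)).
case/mapP=> m' /Fp[eq0 eqs] ->.
rewrite addmC sum_on_mnmD // eqs; split=> // j Sj.
rewrite mnmDE mnm1E eq0 //; case: eqP Si Sj => [->|_]; last by rewrite addn0.
by move=> ->.
Qed.

Lemma form_on_mull m0 s p : form_on m0 s p -> form_on m0 s.+1 (l * p).
Proof.
move=> Fp; rewrite mulr_suml; apply: (big_ind (form_on m0 s.+1)).
- exact: form_on0.
- exact: form_onD.
- by move=> i Si; apply: form_on_mulX.
Qed.

Lemma form_on_mulXl m0 s k p :
  form_on m0 s p -> form_on m0 (k + s) (l ^+ k * p).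
Proof.
move=> Fp; elim: k => [|k IH]; first by rewrite mul1r.
by rewrite exprS -mulrA; apply: form_on_mull.
Qed.

(** Where partial derivatives of forms of degree s live, including s = 0. *)
Definition lower_form_on m0 s p :=
  if s is s'.+1 then form_on m0 s' p else p = 0.

Lemma lower_form_onD m0 s p q :
  lower_form_on m0 s p -> lower_form_on m0 s q -> lower_form_on m0 s (p + q).
Proof. by case: s => [->->|s]; [rewrite /= addr0|apply: form_onD]. Qed.

Lemma lower_form_onZ m0 s a p :
  lower_form_on m0 s p -> lower_form_on m0 s (a *: p).
Proof. by case: s => [->|s]; [rewrite /= scaler0|apply: form_onZ]. Qed.

Lemma form_on_deriv m0 s i p :
  i \in S -> form_on m0 s p -> lower_form_on m0 s p^`M(i).
Proof.
move=> Si Fp; have Fd m : p^`M(i)@_m != 0 ->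
    (forall j, j \notin S -> m j = m0 j) /\ ((\sum_(j in S) m j).+1 = s)%N.
  rewrite mcoeff_mderiv => nz; have /Fp[eq0 eqs] : (m + U_(i))%MM \in msupp p.
    by rewrite mcoeff_msupp; apply: contraNneq nz => ->; rewrite mul0rn.
  rewrite -(sum_on_mnmD m Si); split=> // j Sj; rewrite -eq0 // mnmDE mnm1E.
  by case: eqP Si Sj => [->->|_] //; rewrite addn0.
case: s Fp Fd => [|s] _ Fd /=.
  by apply/mpolyP => m; rewrite mcoeff0; apply/eqP/negPn/negP => /Fd[].
by move=> m; rewrite mcoeff_msupp => /Fd[? []].
Qed.

Lemma deriv_linear_sum i : i \in S -> l^`M(i) = 1.
Proof.
move=> Si; rewrite linear_sum /= (bigD1 i) //= deriv_var eqxx.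
by rewrite big1 ?addr0 // => j /andP[_ /negbTE ne_ji]; rewrite deriv_var ne_ji.
Qed.

Lemma deriv_linear_sumX i k : i \in S -> (l ^+ k.+1)^`M(i) = k.+1%:R *: l ^+ k.
Proof.
move=> Si; elim: k => [|k IH].
  by rewrite expr1 deriv_linear_sum // scale1r.
rewrite exprS mderivM deriv_linear_sum // IH mul1r -scalerAr -exprS.
by rewrite -[k.+2]addn1 natrD scalerDl scale1r addrC.
Qed.

(** A derivative that falls on the power of l costs one factor l; one that falls
    on h leaves a spare factor l and lowers the degree of h.  So only the first
    kind contributes modulo l^(i+1). *)
Lemma derivs_linear_sumX m0 s h (L : seq 'I_n) i :
    form_on m0 s h -> {subset L <= S} ->
  exists2 h', lower_form_on m0 s h' &
    foldr (@mderiv n K) (l ^+ (size L + i) * h) L =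
    ((size L + i) ^_ (size L))%:R *: (l ^+ i * h) + l ^+ i.+1 * h'.
Proof.
move=> Fh; elim: L i => [|x L IH] i subL.
  exists 0; last by rewrite /= ffactn0 scale1r mulr0 addr0.
  by case: s Fh => [|s] _ //=; apply: form_on0.
have Sx : x \in S by rewrite subL ?mem_head.
have [|h' Fh'] := IH i.+1; first by move=> y Ly; rewrite subL // inE Ly orbT.
rewrite /= addSnnS => ->; set C := (_ ^_ size L)%:R.
exists (C *: h^`M(x) + i.+2%:R *: h' + l * h'^`M(x)).
  apply: lower_form_onD; first apply: lower_form_onD.
  - exact/lower_form_onZ/form_on_deriv.
  - exact: lower_form_onZ.
  case: s Fh Fh' {IH} => [|s] /= _; first by move->; rewrite linear0 mulr0.
  move=> /(form_on_deriv Sx); case: s => [->|s]; last exact: form_on_mull.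
  by rewrite mulr0; apply: form_on0.
rewrite mderivD mderivZ (mderivM x (l ^+ i.+1)) (mderivM x (l ^+ i.+2)).
rewrite !deriv_linear_sumX // ffactnSr.
rewrite addKn natrM -/C -!mul_mpolyC mpolyCM !exprS; ring.
Qed.

(** By the previous lemma the map is triangular, with a nonzero falling
    factorial on the diagonal; the error term is l^(i+1) times a form of smaller
    degree, and is removed by induction on that degree. *)
Lemma derivs_linear_sumX_surj m0 s h (L : seq 'I_n) i :
    form_on m0 s h -> {subset L <= S} -> natr_unit_upto K (size L + i + s) ->
  exists2 g, form_on m0 s g &
    foldr (@mderiv n K) (l ^+ (size L + i) * g) L = l ^+ i * h.
Proof.
pose D p := foldr (@mderiv n K) p L.
have DZ a p : D (a *: p) = a *: D p.
  by rewrite /D; elim: (L) => //= x L' ->; rewrite mderivZ.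
have DB p q : D (p - q) = D p - D q.
  by rewrite /D; elim: (L) => //= x L' ->; rewrite mderivB.
move=> + subL; elim: s i h => [|s IH] i h Fh unitK.
all: have [h' Fh' Dh] := derivs_linear_sumX i Fh subL.
all: have nzC : ((size L + i) ^_ (size L))%:R != 0 :> K
   by apply: (natr_ffact_neq0 unitK); lia.
all: set C := _%:R in nzC Dh.
  exists (C^-1 *: h); first exact: form_onZ.
  rewrite -scalerAr -/(D _) DZ /D Dh Fh' mulr0 addr0.
  by rewrite scalerA mulVf // scale1r.
have [|g' Fg' Dg'] := IH i.+1 h' Fh'; first by rewrite addnS addSnnS.
exists (C^-1 *: (h - l * g')); first exact/form_onZ/form_onB/form_on_mull.
rewrite -scalerAr mulrBr mulrA -exprSr -addnS.
by rewrite -/(D _) DZ DB /D Dg' Dh addrK scalerA mulVf // scale1r.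
Qed.

Lemma mdeg_sum_on m :
  (mdeg m = \sum_(i in S) m i + \sum_(i | i \notin S) m i)%N.
Proof. by rewrite mdegE (bigID (mem S)). Qed.

(** Choose g such that l^(|S|c) g and the monomial have the same image under the
    derivation c times in each variable of S.  Their difference is killed by it,
    and as the characteristic is large this excludes every monomial with all
    exponents on S at least c. *)
Lemma straighten_monomial c m :
    (forall i, i \in S -> (c <= m i)%N) -> natr_unit_upto K (mdeg m) ->
  exists g, {in msupp ('X_[m] - l ^+ (#|S| * c) * g), forall m',
    [/\ mdeg m' = mdeg m, forall i, i \notin S -> m' i = m i &
        exists2 i, i \in S & (m' i < c)%N]}.
Proof.
move=> le_cm unitK; pose mS := [multinom (if i \in S then c else 0)%N | i < n].
have le_mS : (mS <= m)%MM.
  by apply/mnm_lepP => i; rewrite mnmE; case: ifP => // /le_cm.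
have sum_mS : (\sum_(i in S) mS i = #|S| * c)%N.
  by under eq_bigr => i Si do rewrite mnmE Si; rewrite sum_nat_const.
have mdeg_mS : mdeg mS = (#|S| * c)%N.
  rewrite mdeg_sum_on sum_mS big1 ?addn0 // => i.
  by rewrite mnmE => /negbTE ->.
have sum_m : (\sum_(i in S) (m - mS)%MM i + #|S| * c = \sum_(i in S) m i)%N.
  rewrite -sum_mS -big_split; apply: eq_bigr => i _ /=.
  by rewrite mnmBE subnK //; apply: (mnm_lepP le_mS).
set s := (\sum_(i in S) (m - mS)%MM i)%N in sum_m.
have subL : {subset m2s mS <= S}.
  move=> i /flattenP[_ /mapP[j _ ->]]; rewrite mem_nseq mnmE.
  by case: ifP => [Sj|_]; rewrite ?ltnn //= => /andP[_ /eqP->].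
have Fh : form_on m s ('X_[m])^`M[mS].
  rewrite mderivmX; apply: form_onZ => m'; rewrite msuppX inE => /eqP->.
  by split=> // i Si; rewrite mnmBE mnmE (negbTE Si) subn0.
have size_L : size (m2s mS) = (#|S| * c)%N by rewrite size_m2s.
have [|g Fg] := @derivs_linear_sumX_surj m s _ (m2s mS) 0 Fh subL.
  move=> k /andP[k0 le_k]; apply: unitK; rewrite k0 (leq_trans le_k) //.
  by rewrite size_L addn0 addnC sum_m mdeg_sum_on leq_addr.
rewrite -mderivm_foldr addn0 mul1r size_L => Dg; exists g.
set q := _ - _; have Fq : form_on m (\sum_(i in S) m i) q.
  apply: form_onB; first by move=> m'; rewrite msuppX inE => /eqP->.
  by rewrite -sum_m addnC; apply: form_on_mulXl.
have Dq : q^`M[mS] = 0 by rewrite mderivmB Dg subrr.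
move=> m' q_m'; have [off_m' on_m'] := Fq _ q_m'.
have deg_m' : mdeg m' = mdeg m.
  by rewrite !mdeg_sum_on on_m'; congr addn; apply: eq_bigr.
split=> //; apply/exists_inP; apply: contraLR q_m'.
rewrite negb_exists_in => /forall_inP le_cm'; rewrite -mcoeff_eq0.
have le_mS' : (mS <= m')%MM.
  apply/mnm_lepP => i; rewrite mnmE; case: ifP => // Si.
  by rewrite leqNgt le_cm'.
have := mcoeff_mderivm mS q (m' - mS); rewrite Dq mcoeff0 addmC submK //.
move/eqP; rewrite eq_sym -mulr_natr mulf_eq0 => /orP[] //.
rewrite natr_prod prodf_seq_eq0 => /hasP[i _ /=]; apply: contraTT => _.
apply: (natr_ffact_neq0 unitK); rewrite (mnm_lepP le_mS') -deg_m' mdegE.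
by rewrite (bigD1 i) //= leq_addr.
Qed.

End Straightening.

(** * Upper bound: standard monomials span the quotient *)

Section SpanModulo.
Variables (K : fieldType) (n : nat) (gs : seq {mpoly K[n]}).
Local Notation J := (ideal_gen gs).
Implicit Types (m : 'X_{1..n}) (p q : {mpoly K[n]}) (P : pred 'X_{1..n}).

Definition spanned_mod P p := exists2 q, J (p - q) & {subset msupp q <= P}.

Lemma spanned_mod0 P : spanned_mod P 0.
Proof.
by exists 0; [rewrite subr0; apply: ideal_gen0|move=> m; rewrite msupp0].
Qed.

Lemma spanned_mod_ideal P p : J p -> spanned_mod P p.
Proof. by move=> Jp; exists 0; [rewrite subr0|move=> m; rewrite msupp0]. Qed.

Lemma spanned_modD P p q :
  spanned_mod P p -> spanned_mod P q -> spanned_mod P (p + q).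
Proof.
move=> [p' Jp Pp'] [q' Jq Pq']; exists (p' + q').
  by rewrite opprD addrACA; apply: ideal_genD.
by move=> m /msuppD_le; rewrite mem_cat => /orP[/Pp'|/Pq'].
Qed.

Lemma spanned_modZ P a p : spanned_mod P p -> spanned_mod P (a *: p).
Proof.
move=> [q Jq Pq]; exists (a *: q).
  by rewrite -scalerBr; apply: ideal_genZ.
by move=> m /msuppZ_le/Pq.
Qed.

Lemma spanned_mod_supp P p :
  {in msupp p, forall m, spanned_mod P 'X_[m]} -> spanned_mod P p.
Proof.
move=> supp_p; rewrite [p]mpolyE big_seq; apply: (big_ind (spanned_mod P)).
- exact: spanned_mod0.
- exact: spanned_modD.
- by move=> m /supp_p; apply: spanned_modZ.
Qed.

End SpanModulo.

Lemma hilbert_series_le_count (K : fieldType) n (gs : seq {mpoly K[n.+1]}) d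
    (P : pred 'X_{1..n.+1}) :
    (forall m, mdeg m = d ->
       spanned_mod gs [pred m' | P m' && (mdeg m' == d)] 'X_[m]) ->
  (hilbert_series (ideal_gen gs) d <= count P (monomials n.+1 d))%N.
Proof.
move=> spanP.
have [b [free_b _]] := hilbert_series_spec d (@ideal_gen0 _ _ gs)
  (@ideal_genZ _ _ gs).
set s := [seq m <- monomials n.+1 d | P m]; rewrite -size_filter -/s.
have mem_s m : m \in s = P m && (mdeg m == d).
  by rewrite mem_filter mem_monomials.
have /fin_all_exists [q qP] i : exists q,
    ideal_gen gs (val (b i) - q) /\ {subset msupp q <= s}.
  have [|q Jq Pq] := @spanned_mod_supp _ _ gs
      [pred m' | P m' && (mdeg m' == d)] (val (b i)).
    by move=> m /(dhomog_mf (dhomog_is_dhomog (b i))); apply: spanP.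
  by exists q; split=> // m /Pq; rewrite mem_s.
apply: (@leq_of_free_matrix K _ _ (fun i k => (q i)@_(nth 0%MM s k))) => c c0.
apply: free_b; have q0 : \sum_i c i *: q i = 0.
  apply/mpolyP => m; rewrite mcoeff0 linear_sum /=.
  have [sm|Nsm] := boolP (m \in s).
    have lt_m : (index m s < size s)%N by rewrite index_mem.
    rewrite -[RHS](c0 (Ordinal lt_m)) /= nth_index //.
    by apply: eq_bigr => i _; rewrite mcoeffZ.
  rewrite big1 // => i _; rewrite mcoeffZ memN_msupp_eq0 ?mulr0 //.
  by apply: contra Nsm => /(proj2 (qP i)).
have -> : \sum_i c i *: mpoly_of_dhomog (b i) =
    \sum_i c i *: (mpoly_of_dhomog (b i) - q i).
  by under [RHS]eq_bigr do rewrite scalerBr; rewrite sumrB q0 subr0.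
apply: (big_ind (ideal_gen gs)); [exact: ideal_gen0|exact: ideal_genD|].
by move=> i _; apply/ideal_genZ/(proj1 (qP i)).
Qed.

Section StandardSpan.
Variables (K : fieldType) (n : nat) (gs : seq {mpoly K[n]}) (phi : nat -> nat).
Local Notation J := (ideal_gen gs).
Implicit Types (m : 'X_{1..n}).

Definition level m r := #|[set i | (phi r <= m i)%N]|.

(** The monomials outside I are those with k = 0.  Straightening with the sets S
    of size r enforces the condition for r, and r runs downwards; so the
    condition for all r > k is what holds at an intermediate stage. *)
Definition standard_above k m := forall r, (k < r <= n)%N -> (level m r < r)%N.

Hypothesis phi_decr : forall r, (0 < r < n)%N -> (phi r.+1 <= phi r)%N.
Hypothesis J_power : forall S : {set 'I_n}, S != set0 ->
  J (linear_sum_on K S ^+ (#|S| * phi #|S|)).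

Let phi_anti r r' : (0 < r)%N -> (r <= r' <= n)%N -> (phi r' <= phi r)%N.
Proof.
move=> r0 /andP[]; elim: r' => [|r' IH]; first by case: r r0.
rewrite leq_eqVlt => /orP[/eqP->|] //; rewrite ltnS => le_rr' lt_r'n.
by apply: leq_trans (phi_decr _) (IH le_rr' (ltnW lt_r'n)); lia.
Qed.

(** When the condition fails for r = k + 1, exactly k + 1 exponents are
    >= phi (k + 1), since the condition holds for r = k + 2.  Straightening on
    that set S brings one of them below phi (k + 1).  It creates no violation
    for larger r, as all exponents on S were >= phi (k + 1) >= phi r before. *)
Lemma standard_above_step k m :
    (k < n)%N -> standard_above k.+1 m -> natr_unit_upto K (mdeg m) ->
  exists2 q, J ('X_[m] - q) &
    {in msupp q, forall m', mdeg m' = mdeg m /\ standard_above k m'}.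
Proof.
move=> lt_kn std_m unitK; have [lt_k|le_k] := ltnP (level m k.+1) k.+1.
  exists 'X_[m]; first by rewrite subrr; apply: ideal_gen0.
  move=> m'; rewrite msuppX inE => /eqP->; split=> // r /andP[].
  rewrite leq_eqVlt => /orP[/eqP<-|lt_kr] // le_rn.
  by apply: std_m; rewrite lt_kr.
pose S := [set i | (phi k.+1 <= m i)%N].
have card_S : #|S| = k.+1.
  apply/eqP; rewrite eqn_leq le_k andbT -ltnS.
  have [lt_kn'|le_nk] := ltnP k.+1 n; last first.
    by have := subset_leq_card (subsetT S); rewrite cardsT card_ord; lia.
  apply: leq_ltn_trans (std_m k.+2 _); last by rewrite leqnn.
  apply/subset_leq_card/subsetP => i; rewrite !inE.
  by apply/leq_trans/phi_decr; lia.
have [|g gP] := straighten_monomial (S := S) (c := phi k.+1) _ unitK.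
  by move=> i; rewrite inE.
exists ('X_[m] - linear_sum_on K S ^+ (#|S| * phi k.+1) * g).
  rewrite opprB addrCA subrr addr0 mulrC -card_S.
  by apply/ideal_genMl/J_power; rewrite -card_gt0 card_S.
move=> m' /gP[deg_m' off_m' [i Si lt_i]]; split=> // r /andP[lt_kr le_rn].
have sub_r : [set j | (phi r <= m' j)%N] \subset [set j | (phi r <= m j)%N].
  apply/subsetP => j; rewrite !inE; have [|/off_m'-> //] := boolP (j \in S).
  by rewrite inE => le_j _; apply: leq_trans le_j; apply: phi_anti; lia.
have [lt_kr'|le_rk] := ltnP k.+1 r.
  apply: leq_ltn_trans (subset_leq_card sub_r) (std_m _ _).
  by rewrite lt_kr'.
have r_k : r = k.+1 by lia.
rewrite {}r_k {lt_kr le_rn r le_rk} in sub_r *; rewrite -[X in (_ < X)%N]card_S.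
apply: proper_card; apply/properP; split=> //.
by exists i => //; rewrite inE -ltnNge.
Qed.

Lemma spanned_mod_standard (P : pred 'X_{1..n}) d m :
    (forall m', standard_above 0 m' -> mdeg m' = d -> P m') ->
    natr_unit_upto K d -> mdeg m = d ->
  spanned_mod gs P 'X_[m].
Proof.
move=> stdP unitK.
suff H k : (k <= n)%N -> forall m, mdeg m = d -> standard_above k m ->
    spanned_mod gs P 'X_[m].
  by move=> dm; apply: (H n) => // r; case/andP; lia.
elim: k => [_|k IH lt_kn] {}m dm std_m.
  exists 'X_[m]; first by rewrite subrr; apply: ideal_gen0.
  by move=> m'; rewrite msuppX inE => /eqP->; apply: stdP.
have [|q Jq qP] := standard_above_step lt_kn std_m; first by rewrite dm.
rewrite -['X_[m]](subrK q); apply: spanned_modD; first exact: spanned_mod_ideal.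
apply: spanned_mod_supp => m' /qP[dm' std_m'].
by apply: IH => //; [apply: ltnW|rewrite dm'].
Qed.

End StandardSpan.

(** * The apolarity pairing and derivations along sets of variables *)

Section Apolarity.
Variables (K : fieldType) (n : nat).
Implicit Types (m : 'X_{1..n}) (f g F G : {mpoly K[n]}).

Definition mfact m : nat := (\prod_i (m i)`!)%N.

(** The value at 0 of f(d/dx) F. *)
Definition apolar f F := \sum_(m <- msupp f) f@_m * (F@_m * (mfact m)%:R).

Lemma apolarwE k f F : (msize f <= k)%N ->
  apolar f F = \sum_(m : 'X_{1..n < k}) f@_m * (F@_m * (mfact m)%:R).
Proof.
move=> le_fk; pose I : subFinType _ := 'X_{1..n < k}.
rewrite /apolar (big_mksub I) //=; first last.
- by move=> m /msize_mdeg_lt/leq_trans/(_ le_fk) ->.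
- exact: msupp_uniq.
by rewrite big_rmcond // => m /memN_msupp_eq0 ->; rewrite mul0r.
Qed.

Lemma apolar_linearr f : scalar (apolar f).
Proof.
move=> a F G; rewrite /apolar mulr_sumr -big_split; apply: eq_bigr => m _ /=.
by rewrite mcoeffD mcoeffZ; ring.
Qed.

Lemma apolar_linearl F : scalar (apolar^~ F).
Proof.
move=> a f g; pose k := maxn (msize (a *: f + g)) (maxn (msize f) (msize g)).
rewrite !(@apolarwE k) ?leq_max ?leqnn ?orbT //.
rewrite mulr_sumr -big_split; apply: eq_bigr => m _ /=.
by rewrite mcoeffD mcoeffZ; ring.
Qed.

Lemma apolarX m F : apolar 'X_[m] F = F@_m * (mfact m)%:R.
Proof. by rewrite /apolar msuppX big_seq1 mcoeffX eqxx mul1r. Qed.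

Lemma apolar0l F : apolar 0 F = 0.
Proof. by rewrite /apolar msupp0 big_nil. Qed.

Lemma apolar0r f : apolar f 0 = 0.
Proof. by rewrite /apolar big1 // => m _; rewrite mcoeff0 mul0r mulr0. Qed.

Lemma apolarDl f g F : apolar (f + g) F = apolar f F + apolar g F.
Proof. by have := apolar_linearl F 1 f g; rewrite scale1r mul1r. Qed.

Lemma apolarDr f F G : apolar f (F + G) = apolar f F + apolar f G.
Proof. by have := apolar_linearr f 1 F G; rewrite scale1r mul1r. Qed.

Lemma apolarZl a f F : apolar (a *: f) F = a * apolar f F.
Proof. by have := apolar_linearl F a f 0; rewrite addr0 apolar0l addr0. Qed.

Lemma mfactU m i : mfact (m + U_(i)) = (mfact m * (m i).+1)%N.
Proof.
rewrite /mfact (bigD1 i) //= [in RHS](bigD1 i) //= mnmDE mnm1E eqxx addn1 factS.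
rewrite mulnAC [in RHS]mulnC -mulnA; congr muln; rewrite mulnC; congr muln.
by apply: eq_bigr => j ne_ji; rewrite mnmDE mnm1E eq_sym (negbTE ne_ji) addn0.
Qed.

(** Adjunction; both sides are linear in f, so monomials suffice. *)
Lemma apolar_mulX i f F : apolar ('X_i * f) F = apolar f F^`M(i).
Proof.
rewrite [f]mpolyE mulr_sumr; elim/big_rec2: _ => [|m y x _ IH].
  by rewrite !apolar0l.
rewrite !apolarDl IH -scalerAr !apolarZl -mpolyXD !apolarX mcoeff_deriv.
by rewrite addmC mfactU natrM -mulr_natr; congr (_ * _ + _); ring.
Qed.

Definition dirderiv (S : {set 'I_n}) F := \sum_(i in S) F^`M(i).

Lemma apolar_linear_sum S f F :
  apolar (linear_sum_on K S * f) F = apolar f (dirderiv S F).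
Proof.
rewrite mulr_suml /dirderiv; elim/big_rec2: _ => [|i x y _ IH].
  by rewrite apolar0l apolar0r.
by rewrite apolarDl apolarDr apolar_mulX IH.
Qed.

Lemma apolar_linear_sumX S k f F :
  apolar (linear_sum_on K S ^+ k * f) F = apolar f (iter k (dirderiv S) F).
Proof.
elim: k f => [|k IH] f; first by rewrite mul1r.
by rewrite exprSr -mulrA IH apolar_linear_sum.
Qed.

Lemma dirderiv_linear S : linear (dirderiv S).
Proof.
move=> a F G; rewrite scaler_sumr -big_split; apply: eq_bigr => i _.
exact: linearP.
Qed.

Lemma dirderivD S F G : dirderiv S (F + G) = dirderiv S F + dirderiv S G.
Proof. by have := dirderiv_linear S 1 F G; rewrite !scale1r. Qed.

Lemma dirderiv0 S : dirderiv S 0 = 0.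
Proof. by rewrite /dirderiv big1 // => i _; rewrite linear0. Qed.

Lemma dirderivZ S a F : dirderiv S (a *: F) = a *: dirderiv S F.
Proof.
by have := dirderiv_linear S a F 0; rewrite dirderiv0 !addr0.
Qed.

Lemma iter_dirderiv_linear S k : linear (iter k (dirderiv S)).
Proof. by move=> a F G; elim: k => //= k ->; rewrite dirderiv_linear. Qed.

Lemma dirderivM S F G :
  dirderiv S (F * G) = dirderiv S F * G + F * dirderiv S G.
Proof.
rewrite mulr_suml mulr_sumr -big_split; apply: eq_bigr => i _.
exact: mderivM.
Qed.

Lemma dirderivX S i : dirderiv S 'X_i = (i \in S)%:R%:MP.
Proof.
rewrite /dirderiv; under eq_bigr => j _ do rewrite deriv_var.
have [Si|Si] := boolP (i \in S).
  rewrite (bigD1 i) //= eqxx big1 ?addr0 // => j /andP[_ /negbTE].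
  by rewrite eq_sym => ->.
by rewrite big1 // => j Sj; case: eqP Si Sj => [->/negbTE->|].
Qed.

Lemma dirderivC S c : dirderiv S c%:MP = 0.
Proof. by rewrite /dirderiv big1 // => i _; rewrite mderivC. Qed.

(** By the Leibniz rule, a factor L whose second derivative is 0 costs at most
    one further derivation, and none if already its derivative is 0. *)
Lemma iter_dirderiv_mul S L e G :
    dirderiv S (dirderiv S L) = 0 -> iter e (dirderiv S) G = 0 ->
  iter ((dirderiv S L != 0) + e) (dirderiv S) (L * G) = 0.
Proof.
move=> DDL DG; have [DL|_] := eqVneq (dirderiv S L) 0.
  have -> : iter (false + e) (dirderiv S) (L * G) =
      L * iter e (dirderiv S) G.
    by elim: e {DG} => //= e ->; rewrite dirderivM DL mul0r add0r.
  by rewrite DG mulr0.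
have -> : iter e.+1 (dirderiv S) (L * G) =
    L * iter e.+1 (dirderiv S) G +
    e.+1%:R *: (dirderiv S L * iter e (dirderiv S) G).
  elim: e {DG} => [|e IH]; first by rewrite /= dirderivM scale1r addrC.
  rewrite iterS IH dirderivD dirderivZ !dirderivM DDL mul0r add0r /=.
  by rewrite -[e.+2%:R]natr1 scalerDl scale1r; ring.
by rewrite iterS DG dirderiv0 !mulr0 scaler0 addr0.
Qed.

Lemma iter_dirderiv_mulX S L k e G :
    dirderiv S (dirderiv S L) = 0 -> iter e (dirderiv S) G = 0 ->
  iter ((dirderiv S L != 0) * k + e) (dirderiv S) (L ^+ k * G) = 0.
Proof.
move=> DDL DG; elim: k => [|k IH]; first by rewrite muln0 mul1r.
by rewrite mulnS -addnA exprS -mulrA iter_dirderiv_mul.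
Qed.

Lemma dhomog_dirderiv S e d F m : F \is d.-homog ->
  (iter e (dirderiv S) F)@_m != 0 -> (mdeg m + e = d)%N.
Proof.
move=> homF; elim: e m => [|e IH] m /=.
  rewrite addn0 => nz; by apply: (dhomog_mf homF); rewrite mcoeff_msupp.
rewrite linear_sum => nz; have [i _ nz_i] : exists2 i, i \in S &
    ((iter e (dirderiv S) F)^`M(i))@_m != 0.
  apply/exists_inP; apply: contraNT nz; rewrite negb_exists_in => /forall_inP z.
  by rewrite big1 // => i /z/negPn/eqP.
rewrite -addSnnS -(IH (m + U_(i))%MM) ?mdegD ?mdeg1 ?addn1 //.
by apply: contraNneq nz_i; rewrite mcoeff_deriv => ->; rewrite mul0rn.
Qed.

End Apolarity.

(** * Lower bound: forms orthogonal to an ideal of powers *)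

Section LowerBound.
Variables (K : fieldType) (n : nat).

(** The number of monomials of degree j - e as a difference of integers, hence 0
    when e > j. *)
Definition nb_monomials j e :=
  if (e <= j)%N then size (monomials n.+1 (j - e)) else 0%N.

(** A form G of degree j is determined by the coefficients of all d_S^(e_S) G
    together with the pairings of P G with lifts b_i of a basis of the quotient:
    if they all vanish, P G is orthogonal to the ideal and to the b_i, hence to
    every form of its degree, so that P G = 0.  Therefore the forms of degree j
    are at most as many, in dimension, as these functionals. *)
Lemma leq_hilbert_power_ideal (Ss : seq {set 'I_n.+1})
    (d e : {set 'I_n.+1} -> nat) (P : {mpoly K[n.+1]}) q j :
    P != 0 -> P \is q.-homog -> natr_unit_upto K (q + j) ->
    {in Ss, forall S G, iter (e S) (dirderiv S) G = 0 ->
       iter (d S) (dirderiv S) (P * G) = 0} ->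
  (nb_monomials j 0 <= \sum_(S <- Ss) nb_monomials j (e S) +
     hilbert_series (ideal_gen [seq linear_sum_on K U ^+ d U | U <- Ss])
       (q + j))%N.
Proof.
move=> nzP homP unitK killP; set gs := [seq _ | U <- Ss].
have [b [_ gen_b]] := hilbert_series_spec (q + j) (@ideal_gen0 _ _ gs)
  (@ideal_genZ _ _ gs).
set D := hilbert_series _ _ in b gen_b *.
pose s : seq {mpoly K[n.+1]} := [seq 'X_[m] | m <- monomials n.+1 j].
pose mons (S : {set 'I_n.+1}) :=
  if (e S <= j)%N then monomials n.+1 (j - e S) else [::].
pose ts : seq ({set 'I_n.+1} * 'X_{1..n.+1} + 'I_D) :=
  [seq inl (U, m) | U <- Ss, m <- mons U] ++ [seq inr i | i <- enum 'I_D].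
pose phi (t : {set 'I_n.+1} * 'X_{1..n.+1} + 'I_D) (G : {mpoly K[n.+1]}) : K :=
  match t with
  | inl (U, m) => (iter (e U) (dirderiv U) G)@_m
  | inr i => apolar (val (b i)) (P * G)
  end.
have size_ts : (size ts = \sum_(S <- Ss) nb_monomials j (e S) + D)%N.
  rewrite size_cat size_allpairs_dep size_map size_enum_ord sumnE big_map.
  congr addn; apply: eq_bigr => S _; rewrite /mons /nb_monomials.
  by case: ifP.
have size_s : size s = nb_monomials j 0 by rewrite size_map /nb_monomials subn0.
rewrite -size_ts -size_s; apply: (leq_of_separating (phi := phi)).
  move=> [[S m]|i] a F G /=.
    by rewrite iter_dirderiv_linear mcoeffD mcoeffZ.
  by rewrite mulrDr -scalerAr apolar_linearr.
move=> c; set G := \sum_i _ => c0.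
have s_nth i : (i < size s)%N -> s`_i = 'X_[nth 0%MM (monomials n.+1 j) i].
  by rewrite size_map => lt_i; rewrite (nth_map 0%MM).
have homG : G \is j.-homog.
  rewrite rpred_sum // => i _; apply: rpredZ; rewrite s_nth // dhomogX.
  by rewrite -mem_monomials mem_nth // -(size_map (fun m => 'X_[K, m])).
have homPG : P * G \is (q + j).-homog by apply: dhomogM.
have kill_S S : S \in Ss -> iter (d S) (dirderiv S) (P * G) = 0.
  move=> Ss_S; apply: killP => //; apply/mpolyP => m; rewrite mcoeff0.
  apply/eqP/negPn/negP => nz; have dm := dhomog_dirderiv homG nz.
  move/negP: nz; apply; apply/eqP; apply: (c0 (inl (S, m))).
  rewrite mem_cat; apply/orP; left; apply/allpairsPdep; exists S, m; split=> //.
  by rewrite /mons -dm leq_addl addnK mem_monomials.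
have kill_J p : ideal_gen gs p -> apolar p (P * G) = 0.
  move: p; apply: ideal_gen_ind; first exact: apolar0l.
    by move=> p p' p0 p'0; rewrite apolarDl p0 p'0 addr0.
  move=> _ p /mapP[S Ss_S ->].
  by rewrite mulrC apolar_linear_sumX kill_S ?apolar0r.
have PG0 : P * G = 0.
  apply/mpolyP => m; rewrite mcoeff0.
  have [dm|ndm] := eqVneq (mdeg m) (q + j)%N; last first.
    exact: (dhomog_nemf_coeff homPG).
  have homX : ('X_[m] : {mpoly K[n.+1]}) \is (q + j).-homog.
    by rewrite dhomogX; apply/eqP.
  have [c' Jc'] := gen_b (DHomog homX).
  have : apolar 'X_[m] (P * G) = 0.
    rewrite -['X_[m]](subrK (\sum_i c' i *: mpoly_of_dhomog (b i))).
    rewrite apolarDl (kill_J _ Jc') add0r.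
    elim/big_rec: _ => [|i x _ x0]; first exact: apolar0l.
    rewrite apolarDl apolarZl x0 addr0; have := c0 (inr i); rewrite /= => ->.
      by rewrite mulr0.
    by rewrite mem_cat map_f ?mem_enum ?orbT.
  rewrite apolarX => /eqP; rewrite mulf_eq0 => /orP[/eqP //|].
  rewrite natr_prod prodf_seq_eq0 => /hasP[i _ /= z].
  suff : (m i ^_ m i)%:R != 0 :> K by rewrite ffactnn z.
  apply: (natr_ffact_neq0 unitK).
  by rewrite leqnn -dm mdegE (bigD1 i) //= leq_addr.
have G0 : G = 0 by apply/eqP; move/eqP: PG0; rewrite mulf_eq0 (negbTE nzP).
move=> i; have lt_i : (i < size (monomials n.+1 j))%N.
  by rewrite -(size_map (fun m => 'X_[K, m])).
have := congr1 (mcoeff (nth 0%MM (monomials n.+1 j) i)) G0.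
rewrite mcoeff0 linear_sum (bigD1 i) //= mcoeffZ s_nth // mcoeffX eqxx mulr1.
rewrite big1 ?addr0 // => k ne_ki; have lt_k : (k < size (monomials n.+1 j))%N.
  by rewrite -(size_map (fun m => 'X_[K, m])).
rewrite mcoeffZ s_nth // mcoeffX nth_uniq ?uniq_monomials //.
by rewrite -val_eqE in ne_ki; rewrite (negbTE ne_ki) mulr0.
Qed.

End LowerBound.

(** * Counting monomials in three variables *)

Lemma count_monomials_ge n (f : 'X_{1..n.+1}) j :
  count (fun m => (f <= m)%MM) (monomials n.+1 j) = nb_monomials n j (mdeg f).
Proof.
rewrite /nb_monomials; case: ifP => [le_fj|/negbT gt_fj].
  rewrite -size_filter -[RHS](size_map (mnm_add f)); apply/perm_size/uniq_perm.
  - by rewrite filter_uniq ?uniq_monomials.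
  - by rewrite map_inj_uniq ?uniq_monomials // => x y; apply: addmI.
  move=> m; rewrite mem_filter mem_monomials.
  apply/andP/mapP=> [[le_fm /eqP dm]|[m']].
    exists (m - f)%MM; last by rewrite addmC submK.
    by rewrite mem_monomials -dm -{2}(submK le_fm) mdegD addnK.
  by rewrite mem_monomials => /eqP dm' ->; rewrite lem_addr mdegD dm' subnKC.
apply/eqP; rewrite -leqn0 leqNgt -has_count; apply: contra gt_fj.
case/hasP => m; rewrite mem_monomials => /eqP<- le_fm.
by rewrite -(submK le_fm) mdegD leq_addl.
Qed.

(** With truncated subtraction the formula also covers e > j. *)
Lemma nb_monomials2E j e :
  (2 * nb_monomials 2 j e = (j + 1 - e) * (j + 2 - e))%N.
Proof.
rewrite /nb_monomials; case: (leqP e j) => [le_ej|lt_je]; last first.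
  by rewrite (_ : j + 1 - e = 0)%N ?muln0 //; lia.
rewrite /monomials mpoly.size_basis -bin_sub ?leq_addr // addKn mulnC.
have := bin_ffact (j - e + 2) 2; rewrite ffactnS ffactn1 => ->.
rewrite (_ : j + 1 - e = j - e + 1)%N; last lia.
rewrite (_ : j + 2 - e = j - e + 2)%N; last lia.
by rewrite mulnC addn2 addn1.
Qed.

Lemma nb_monomials_gt j e : (j < e)%N -> nb_monomials 2 j e = 0%N.
Proof. by rewrite ltnNge /nb_monomials => /negbTE->. Qed.

(** The linear (u = v) and the almost linear degree functions at once. *)
Definition near_linear (a b c k u v : nat) :=
  [/\ 0 < k, u <= v <= 1, b = c + k + u & a = c + 2 * k + v]%N.

Section LineMultiplicities.
Local Notation N := (nb_monomials 2).

Let N_exact J e : (e <= J + 2)%N ->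
  2%:Z * (N J e)%:Z = (J%:Z - e%:Z + 1) * (J%:Z - e%:Z + 2%:Z).
Proof. by move=> le_e; have := nb_monomials2E J e; nia. Qed.

Let N_le J e : 2%:Z * (N J e)%:Z <= (J%:Z - e%:Z + 1) * (J%:Z - e%:Z + 2%:Z).
Proof. by have := nb_monomials2E J e; case: (leqP e (J + 1)) => ?; nia. Qed.

Let N_shift J e J' e' : (J + e' = J' + e)%N -> N J e = N J' e'.
Proof.
move=> eqJ; have := nb_monomials2E J e; have := nb_monomials2E J' e'.
have -> : (J + 1 - e = J' + 1 - e')%N by lia.
have -> : (J + 2 - e = J' + 2 - e')%N by lia.
by lia.
Qed.

(** The three lines X_i = 0 are removed n1 times each, the three lines
    X_i = X_k n2 times each.  While a multiplicity is 0 the corresponding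
    correction terms on the left vanish; otherwise all the numbers of monomials
    that matter are given by the quadratic formula. *)
Lemma line_multiplicities_count a b c k u v j n1 n2 j' e1 e2 e3 :
    (0 < c)%N -> near_linear a b c k u v -> (j + 2 < a + b + c)%N ->
    n1 = (j + 2 - (a + b))%N -> n2 = (j + k + 2 - (a + b + c))%N ->
    j = (n1 * 3 + n2 * 3 + j')%N -> (e1 + n1 + 2 * n2 = a)%N ->
    (e2 + 2 * n1 + 2 * n2 = 2 * b)%N -> (e3 + 3 * n1 = 3 * c)%N ->
  (N j 0 + 6 * N j (a + b) + 3 * N j (a + 2 * c) + 3 * N j (2 * b + c) +
     (3 * N j' e1 + 3 * N j' e2 + N j' e3) <=
   N j' 0 + (3 * N j a + 3 * N j (2 * b) + N j (3 * c)))%N.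
Proof.
move=> c0 [k0 uv eb ea] lt_j en1 en2 ej ee1 ee2 ee3.
have uvE : (u = 0 /\ v = 0 \/ u = 0 /\ v = 1 \/ u = 1 /\ v = 1)%N by lia.
have [n1_0|n1_gt0] := posnP n1; have [n2_0|n2_gt0] := posnP n2.
- have -> : j' = j by lia.
  have -> : e1 = a by lia.
  have -> : (e2 = 2 * b)%N by lia.
  have -> : (e3 = 3 * c)%N by lia.
  rewrite (nb_monomials_gt (e := (a + b)%N)); last lia.
  rewrite (nb_monomials_gt (e := (a + 2 * c)%N)); last lia.
  by rewrite (nb_monomials_gt (e := (2 * b + c)%N)); lia.
- rewrite (nb_monomials_gt (e := (a + b)%N)); last lia.
  have := N_exact (isT : 0 <= j + 2)%N; have := N_exact (isT : 0 <= j' + 2)%N.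
  have := N_le j' e1; have := N_le j' e2; have := N_le j' e3.
  have /N_exact : (a <= j + 2)%N by lia.
  have /N_exact : (2 * b <= j + 2)%N by lia.
  have /N_exact : (3 * c <= j + 2)%N by lia.
  have /N_exact : (a + 2 * c <= j + 2)%N by lia.
  have /N_exact : (2 * b + c <= j + 2)%N by lia.
  by case: uvE => [[? ?]|[[? ?]|[? ?]]]; lia.
- rewrite (nb_monomials_gt (e := (a + 2 * c)%N)); last lia.
  rewrite (nb_monomials_gt (e := (2 * b + c)%N)); last lia.
  (* the lines X_i = 0 miss (1:1:1): as many conditions there as before *)
  have <- : N j' e3 = N j (3 * c) by apply: N_shift; lia.
  have := N_exact (isT : 0 <= j + 2)%N; have := N_exact (isT : 0 <= j' + 2)%N.
  have := N_le j' e1; have := N_le j' e2.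
  have /N_exact : (a <= j + 2)%N by lia.
  have /N_exact : (2 * b <= j + 2)%N by lia.
  have /N_exact : (a + b <= j + 2)%N by lia.
  by case: uvE => [[? ?]|[[? ?]|[? ?]]]; lia.
have := N_exact (isT : 0 <= j + 2)%N; have := N_exact (isT : 0 <= j' + 2)%N.
have := N_le j' e1; have := N_le j' e2; have := N_le j' e3.
have /N_exact : (a <= j + 2)%N by lia.
have /N_exact : (2 * b <= j + 2)%N by lia.
have /N_exact : (3 * c <= j + 2)%N by lia.
have /N_exact : (a + b <= j + 2)%N by lia.
have /N_exact : (a + 2 * c <= j + 2)%N by lia.
have /N_exact : (2 * b + c <= j + 2)%N by lia.
by case: uvE => [[? ?]|[[? ?]|[? ?]]]; lia.
Qed.

Lemma line_multiplicities a b c k u v j :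
    (0 < c)%N -> near_linear a b c k u v -> (j + 2 < a + b + c)%N ->
  exists n1 n2 j' e1 e2 e3,
    [/\ (j = n1 * 3 + n2 * 3 + j')%N, (e1 + n1 + 2 * n2 = a)%N,
        (e2 + 2 * n1 + 2 * n2 = 2 * b)%N, (e3 + 3 * n1 = 3 * c)%N &
    (N j 0 + 6 * N j (a + b) + 3 * N j (a + 2 * c) + 3 * N j (2 * b + c) +
       (3 * N j' e1 + 3 * N j' e2 + N j' e3) <=
     N j' 0 + (3 * N j a + 3 * N j (2 * b) + N j (3 * c)))%N].
Proof.
move=> c0 lin lt_j; have [k0 uv eb ea] := lin.
(* how often each line is a fixed component by Bezout's theorem *)
have [n1 n1E] : exists n1, n1 = (j + 2 - (a + b))%N by eexists.
have [n2 n2E] : exists n2, n2 = (j + k + 2 - (a + b + c))%N by eexists.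
have [? ? ? ?] : [/\ (n1 * 3 + n2 * 3 <= j)%N, (n1 + 2 * n2 <= a)%N,
    (2 * n1 + 2 * n2 <= 2 * b)%N & (3 * n1 <= 3 * c)%N] by split; lia.
exists n1, n2, (j - n1 * 3 - n2 * 3)%N, (a - n1 - 2 * n2)%N.
exists (2 * b - 2 * n1 - 2 * n2)%N, (3 * c - 3 * n1)%N.
split; try lia.
by apply: line_multiplicities_count c0 lin lt_j n1E n2E _ _ _ _; lia.
Qed.

End LineMultiplicities.

(** * The two ideals in three variables *)

Local Notation o0 := (@Ordinal 3 0 isT).
Local Notation o1 := (@Ordinal 3 1 isT).
Local Notation o2 := (@Ordinal 3 2 isT).

Lemma forall3 (P : 'I_3 -> Prop) : P o0 -> P o1 -> P o2 -> forall i, P i.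
Proof.
move=> P0 P1 P2 [[|[|[|//]]] lti].
- by rewrite (_ : Ordinal lti = o0) //; apply: val_inj.
- by rewrite (_ : Ordinal lti = o1) //; apply: val_inj.
- by rewrite (_ : Ordinal lti = o2) //; apply: val_inj.
Qed.

Lemma big3 (R : Type) (idx : R) (op : Monoid.law idx) (F : 'I_3 -> R) :
  \big[op/idx]_i F i = op (op (F o0) (F o1)) (F o2).
Proof.
rewrite !big_ord_recr big_ord0 /= Monoid.mul1m.
by congr (op (op (F _) (F _)) (F _)); apply: val_inj.
Qed.

Lemma big_in3 (R : Type) (idx : R) (op : Monoid.law idx) (A : {set 'I_3})
    (F : 'I_3 -> R) :
  \big[op/idx]_(i in A) F i =
  op (op (if o0 \in A then F o0 else idx) (if o1 \in A then F o1 else idx))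
     (if o2 \in A then F o2 else idx).
Proof. by rewrite big_mkcond big3. Qed.

Definition subset3 (x y z : bool) : {set 'I_3} :=
  [set i : 'I_3 | nth false [:: x; y; z] i].

Lemma card_set3 (A : {set 'I_3}) :
  #|A| = ((o0 \in A) + (o1 \in A) + (o2 \in A))%N.
Proof. by rewrite -sum1_card big_mkcond big3; do 3 case: ifP => _. Qed.

Definition nonempty_subsets3 : seq {set 'I_3} :=
  [:: subset3 true false false; subset3 false true false;
      subset3 false false true; subset3 true true false;
      subset3 true false true; subset3 false true true;
      subset3 true true true].

Lemma mem_nonempty_subsets3 (A : {set 'I_3}) :
  (A \in nonempty_subsets3) = (A != set0).
Proof.
have -> : A = subset3 (o0 \in A) (o1 \in A) (o2 \in A).
  by apply/setP; apply: forall3; rewrite inE.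
rewrite -card_gt0 card_set3 !inE /=.
case: (o0 \in A); case: (o1 \in A); case: (o2 \in A); rewrite ?eqxx ?orbT //.
apply/negP; do ?case/orP; move=> /eqP/setP H;
  by have := H o0; have := H o1; have := H o2; rewrite !inE.
Qed.

Definition mnm3 (x y z : nat) : 'X_{1..3} := [multinom [tuple x; y; z]].

Lemma mdeg_mnm3 x y z : mdeg (mnm3 x y z) = (x + y + z)%N.
Proof. by rewrite mdegE big3. Qed.

Lemma lem_mnm3 x y z (m : 'X_{1..3}) :
  (mnm3 x y z <= m)%MM = [&& x <= m o0, y <= m o1 & z <= m o2]%N.
Proof.
apply/mnm_lepP/and3P => [le_m|[le0 le1 le2]].
  by split; [exact: (le_m o0)|exact: (le_m o1)|exact: (le_m o2)].
exact: forall3.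
Qed.

Section ThreeVariables.
Variables (K : fieldType) (phi : nat -> nat).

Lemma J_idealE : J_ideal K phi =
  ideal_gen [seq linear_sum_on K U ^+ (#|U| * phi #|U|)
            | U <- nonempty_subsets3].
Proof.
rewrite /J_ideal /=; congr ideal_gen.
rewrite !card_set3 /linear_sum_on !big_in3 !inE /= ?mul1n.
by rewrite !(addr0, add0r, mul1n).
Qed.

Definition I_exponents : seq 'X_{1..3} :=
  let a := phi 1 in let b := phi 2 in let c := phi 3 in
  [:: mnm3 a 0 0; mnm3 0 a 0; mnm3 0 0 a; mnm3 b b 0; mnm3 b 0 b;
      mnm3 0 b b; mnm3 c c c].

Lemma mpolyX_mnm3 x y z : 'X_[mnm3 x y z] =
  'X_o0 ^+ x * 'X_o1 ^+ y * 'X_o2 ^+ z :> {mpoly K[3]}.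
Proof. by rewrite mpolyXE_id big3. Qed.

Lemma I_idealE : I_ideal K phi =
  ideal_gen [seq 'X_[g] : {mpoly K[3]} | g <- I_exponents].
Proof.
by rewrite /I_ideal /= !mpolyX_mnm3 !expr0 !(mulr1, mul1r) !exprMn.
Qed.

End ThreeVariables.

Section Count.
Variable phi : nat -> nat.
Local Notation a := (phi 1).
Local Notation b := (phi 2).
Local Notation c := (phi 3).
Local Notation N := (nb_monomials 2).

Definition I_standard (m : 'X_{1..3}) :=
  ~~ has (fun g => (g <= m)%MM) (I_exponents phi).

Lemma standard_above_I m : standard_above phi 0 m -> I_standard m.
Proof.
move=> std; move: (std 1 isT) (std 2 isT) (std 3 isT).
rewrite /level !card_set3 !inE /I_standard /= !lem_mnm3 !leq0n !andbT /= orbF.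
by do 9?case: (phi _ <= _)%N.
Qed.

(** The indicator of the standard monomials is an alternating sum over the
    chains of nonempty sets of variables, a chain standing for the monomials
    divisible by the generators of I on all its members.  The term in a + b + c
    comes from the six flags. *)
Lemma count_I_standard j : (c <= b <= a)%N ->
  (count I_standard (monomials 3 j) +
     (3 * N j a + 3 * N j (2 * b) + N j (3 * c)) + 6 * N j (a + b + c) =
   N j 0 + 6 * N j (a + b) + 3 * N j (a + 2 * c) + 3 * N j (2 * b + c))%N.
Proof.
case/andP=> le_cb le_ba.
have NE x y z : N j (x + y + z) =
    count (fun m => (mnm3 x y z <= m)%MM) (monomials 3 j).
  by rewrite count_monomials_ge mdeg_mnm3.
transitivity (count I_standard (monomials 3 j) +
  (N j (a + 0 + 0) + N j (0 + a + 0) + N j (0 + 0 + a) +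
   (N j (b + b + 0) + N j (b + 0 + b) + N j (0 + b + b)) + N j (c + c + c)) +
   (N j (a + b + c) + N j (a + c + b) + N j (b + a + c) + N j (b + c + a) +
    N j (c + a + b) + N j (c + b + a)))%N.
  rewrite !(addn0, add0n) (_ : b + b = 2 * b)%N; last lia.
  rewrite (_ : c + c + c = 3 * c)%N; last lia.
  rewrite (_ : a + c + b = a + b + c)%N; last lia.
  rewrite (_ : b + a + c = a + b + c)%N; last lia.
  rewrite (_ : b + c + a = a + b + c)%N; last lia.
  rewrite (_ : c + a + b = a + b + c)%N; last lia.
  rewrite (_ : c + b + a = a + b + c)%N; last lia.
  by lia.
transitivity (N j (0 + 0 + 0) +
  (N j (a + b + 0) + N j (a + 0 + b) + N j (b + a + 0) + N j (0 + a + b) +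
   N j (b + 0 + a) + N j (0 + b + a)) +
  (N j (a + c + c) + N j (c + a + c) + N j (c + c + a)) +
  (N j (b + b + c) + N j (b + c + b) + N j (c + b + b)))%N; last first.
  rewrite !(addn0, add0n) (_ : b + a = a + b)%N; last lia.
  rewrite (_ : a + c + c = a + 2 * c)%N; last lia.
  rewrite (_ : c + a + c = a + 2 * c)%N; last lia.
  rewrite (_ : c + c + a = a + 2 * c)%N; last lia.
  rewrite (_ : b + b + c = 2 * b + c)%N; last lia.
  rewrite (_ : b + c + b = 2 * b + c)%N; last lia.
  rewrite (_ : c + b + b = 2 * b + c)%N; last lia.
  by lia.
have countE (P : pred 'X_{1..3}) s : count P s = (\sum_(m <- s) P m)%N.
  by elim: s => [|m s IH]; rewrite ?big_nil ?big_cons //= IH.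
rewrite !NE !countE -!big_split; apply: eq_bigr => m _ /=.
rewrite /I_standard /= !lem_mnm3 !leq0n /= !andbT orbF.
have mono x : ((a <= x) ==> (b <= x))%N && ((b <= x) ==> (c <= x))%N.
  by apply/andP; split; apply/implyP; apply: leq_trans.
move: (mono (m o0)) (mono (m o1)) (mono (m o2)).
by do 9?[case: (phi _ <= _)%N].
Qed.

End Count.

(** * The product of the six lines *)

Section LineProduct.
Variable K : fieldType.
Implicit Types (U : {set 'I_3}) (i : 'I_3).
Local Notation X0 := ('X_o0 : {mpoly K[3]}).
Local Notation X1 := ('X_o1 : {mpoly K[3]}).
Local Notation X2 := ('X_o2 : {mpoly K[3]}).

Definition six_lines n1 n2 : {mpoly K[3]} :=
  X0 ^+ n1 * (X1 ^+ n1 * (X2 ^+ n1 *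
    ((X0 - X1) ^+ n2 * ((X0 - X2) ^+ n2 * (X1 - X2) ^+ n2)))).

Lemma dhomog_six_lines n1 n2 : six_lines n1 n2 \is (n1 * 3 + n2 * 3).-homog.
Proof.
have homX i : ('X_i : {mpoly K[3]}) \is 1.-homog.
  by rewrite dhomogX; apply/eqP/mdeg1.
have homXB i i' : ('X_i - 'X_i' : {mpoly K[3]}) \is 1.-homog by rewrite rpredB.
rewrite (_ : n1 * 3 + n2 * 3 = 1 * n1 + (1 * n1 + (1 * n1 +
  (1 * n2 + (1 * n2 + 1 * n2)))))%N; last lia.
by do ![apply: dhomogM]; apply: dhomogMn.
Qed.

Lemma six_lines_neq0 n1 n2 : six_lines n1 n2 != 0.
Proof.
have nzX i : 'X_i != 0 :> {mpoly K[3]}.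
  by rewrite -msize_poly_eq0 msizeX.
have nzXB i i' : i != i' -> 'X_i - 'X_i' != 0 :> {mpoly K[3]}.
  move=> ne_ii'; apply/eqP => /(congr1 (mcoeff U_(i))) /eqP.
  rewrite mcoeffB mcoeff0 !mcoeffXU eqxx (eq_sym i') (negbTE ne_ii') subr0.
  by rewrite oner_eq0.
by rewrite /six_lines !mulf_neq0 ?expf_neq0 ?nzX ?nzXB.
Qed.

(** X_i is killed by d_U unless i is in U, and X_i - X_k is killed unless U
    separates i from k. *)
Lemma iter_dirderiv_six_lines n1 n2 U e G : iter e (dirderiv U) G = 0 ->
  iter (#|U| * n1 + (((o0 \in U) (+) (o1 \in U)) + ((o0 \in U) (+) (o2 \in U)) +
         ((o1 \in U) (+) (o2 \in U))) * n2 + e)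
    (dirderiv U) (six_lines n1 n2 * G) = 0.
Proof.
move=> DG.
have DX i : dirderiv U ('X_i : {mpoly K[3]}) = (i \in U)%:R%:MP.
  exact: dirderivX.
have DXB i i' : dirderiv U ('X_i - 'X_i' : {mpoly K[3]}) =
    ((i \in U)%:R - (i' \in U)%:R)%:MP.
  by rewrite -scaleN1r dirderivD dirderivZ !DX scaleN1r mpolyCB.
have nzX i : (dirderiv U ('X_i : {mpoly K[3]}) != 0) = (i \in U).
  by rewrite DX mpolyC_eq0; case: (i \in U); rewrite ?eqxx ?oner_eq0.
have nzXB i i' : (dirderiv U ('X_i - 'X_i' : {mpoly K[3]}) != 0) =
    (i \in U) (+) (i' \in U).
  rewrite DXB mpolyC_eq0; case: (i \in U); case: (i' \in U) => /=;
  by rewrite ?subrr ?subr0 ?sub0r ?oppr_eq0 ?eqxx ?oner_eq0.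
have step i k d (F : {mpoly K[3]}) : iter d (dirderiv U) F = 0 ->
    iter ((i \in U) * k + d) (dirderiv U) ('X_i ^+ k * F) = 0.
  by rewrite -nzX; apply: iter_dirderiv_mulX; rewrite DX dirderivC.
have stepB i i' k d (F : {mpoly K[3]}) : iter d (dirderiv U) F = 0 ->
    iter (((i \in U) (+) (i' \in U)) * k + d) (dirderiv U)
      (('X_i - 'X_i') ^+ k * F) = 0.
  by rewrite -nzXB; apply: iter_dirderiv_mulX; rewrite DXB dirderivC.
have := step o0 n1 _ _ (step o1 n1 _ _ (step o2 n1 _ _ (stepB o0 o1 n2 _ _
  (stepB o0 o2 n2 _ _ (stepB o1 o2 n2 _ _ DG))))).
by rewrite /six_lines card_set3 !mulrA !mulnDl !addnA.
Qed.

End LineProduct.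

(** * The Hilbert function of the ideal of powers *)

Section HilbertPowers.
Variables (K : fieldType) (phi : nat -> nat) (k u v : nat).
Local Notation a := (phi 1).
Local Notation b := (phi 2).
Local Notation c := (phi 3).
Hypothesis c_gt0 : (0 < c)%N.
Hypothesis phi_near_linear : near_linear a b c k u v.
Hypothesis unitK : natr_unit_upto K (a + b + c - 2).

Let phi_anti : (c <= b <= a)%N.
Proof. by case: phi_near_linear; lia. Qed.

Lemma mdeg_I_standard m : I_standard phi m -> (mdeg m + 2 < a + b + c)%N.
Proof.
rewrite /I_standard /= !lem_mnm3 !leq0n !andbT /= orbF mdegE big3 /=.
have := phi_anti; lia.
Qed.

Let gs : seq {mpoly K[3]} :=
  [seq linear_sum_on K U ^+ (#|U| * phi #|U|) | U <- nonempty_subsets3].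

Lemma spanned_mod_I_standard m : (mdeg m <= a + b + c - 2)%N ->
  spanned_mod gs [pred m' | I_standard phi m' && (mdeg m' == mdeg m)] 'X_[m].
Proof.
move=> le_m; apply: (@spanned_mod_standard _ _ _ phi _ _ _ (mdeg m)) => //.
- have := phi_anti; case/andP=> ? ? [|[|[|r]]] //.
- move=> A nzA; apply: ideal_gen_mem.
  by apply/mapP; exists A; rewrite ?mem_nonempty_subsets3.
- by move=> m' std dm'; rewrite inE dm' eqxx andbT; apply: standard_above_I.
- exact: natr_unit_uptoS unitK.
Qed.

(** In degree a + b + c - 2 there are no standard monomials left, so every
    monomial is spanned by the empty set. *)
Lemma ideal_gen_high_degree m :
  (a + b + c - 2 <= mdeg m)%N -> ideal_gen gs 'X_[m].
Proof.
move: {2}(mdeg m - _)%N (erefl (mdeg m - (a + b + c - 2))%N) => d.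
elim: d m => [|d IH] m dm le_m.
  have [|q Jq std_q] := spanned_mod_I_standard (m := m); first by lia.
  suff q0 : q = 0 by move: Jq; rewrite q0 subr0.
  apply: msuppnil0; case: (msupp q) std_q => // m' s std.
  have := std m' (mem_head _ _); rewrite inE => /andP[/mdeg_I_standard + /eqP].
  by lia.
have [i nz_i] : exists i, m i != 0%N.
  apply/existsP; rewrite -negb_forall; apply/negP => /forallP m0.
  suff : m = 0%MM by move=> m_0; rewrite m_0 mdeg0 in dm.
  by apply/mnmP => i; rewrite mnm0E; apply/eqP.
have le_Um : (U_(i) <= m)%MM by rewrite lep1mP.
have deg_mU : (mdeg (m - U_(i)) + 1 = mdeg m)%N.
  by rewrite -{2}(submK le_Um) mdegD mdeg1.
by rewrite -(submK le_Um) mpolyXD mulrC; apply/ideal_genMl/IH; lia.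
Qed.

Lemma hilbert_powers_le j :
  (hilbert_series (ideal_gen gs) j <= count (I_standard phi) (monomials 3 j))%N.
Proof.
apply: hilbert_series_le_count => m dm.
have [le_m|/ltnW le_m] := leqP (mdeg m) (a + b + c - 2).
  by rewrite -dm; apply: spanned_mod_I_standard.
exact/spanned_mod_ideal/ideal_gen_high_degree.
Qed.

Lemma hilbert_powers_ge j :
  (count (I_standard phi) (monomials 3 j) <= hilbert_series (ideal_gen gs) j)%N.
Proof.
have [lt_j|le_j] := ltnP (j + 2) (a + b + c); last first.
  rewrite leqNgt; apply: contraTN isT => /(leq_ltn_trans (leq0n _)).
  rewrite -has_count => /hasP[m].
  by rewrite mem_monomials => /eqP dm /mdeg_I_standard; lia.
have [n1 [n2 [j' [e1 [e2 [e3 [def_j E1 E2 E3 ineq]]]]]]] :=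
  line_multiplicities c_gt0 phi_near_linear lt_j.
pose e (U : {set 'I_3}) := nth 0%N [:: 0; e1; e2; e3]%N #|U|.
have killP : {in nonempty_subsets3, forall U G,
    iter (e U) (dirderiv U) G = 0 ->
    iter (#|U| * phi #|U|) (dirderiv U) (six_lines K n1 n2 * G) = 0}.
  move=> U _ G /(iter_dirderiv_six_lines n1 n2); rewrite /e card_set3.
  by case: (o0 \in U); case: (o1 \in U); case: (o2 \in U);
     move/(eq_ind _ (fun d => iter d _ _ = 0)); apply;
     rewrite !(addn0, add0n) ?addn1 /=; lia.
have unit_j : natr_unit_upto K (n1 * 3 + n2 * 3 + j').
  by apply: natr_unit_uptoS unitK; lia.
have := leq_hilbert_power_ideal (six_lines_neq0 K n1 n2)
  (dhomog_six_lines K n1 n2) unit_j killP.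
rewrite -def_j -/gs !big_cons big_nil /e !card_set3 !inE /=.
rewrite !(addn0, add0n) ?addn1 /=.
have := count_I_standard j phi_anti.
rewrite (nb_monomials_gt (e := (a + b + c)%N)); last lia.
lia.
Qed.

End HilbertPowers.

(** * Almost linear degree functions and the characteristic *)

Lemma natr_unit_upto_pchar (K : fieldType) B :
    ([pchar K] =i pred0 \/ exists2 p, p \in [pchar K] & (B < p)%N) ->
  natr_unit_upto K B.
Proof.
case=> [/pcharf0P K0|[p pK lt_Bp]] k /andP[k0 le_kB]; first by rewrite K0 -lt0n.
by rewrite -(dvdn_pcharf pK) gtnNdvd // (leq_ltn_trans le_kB).
Qed.

Lemma near_linear_degree (phi : nat -> nat) :
    linear_degree_function phi \/ almost_linear_degree_function phi ->
  (0 < phi 3)%N /\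
  exists k u v, near_linear (phi 1%N) (phi 2%N) (phi 3%N) k u v.
Proof.
case=> [[pos [k [l [k0 l0 phiE]]]]|[pos [k k0 phiE]]]; split; try exact: pos.
  by exists k, 0%N, 0%N; split; rewrite // !phiE //; lia.
have := phiE 1%N isT; have := phiE 2%N isT => h2 h1.
have [h|[h|[h|h]]] : (phi 2 = phi 3 + k /\ phi 1 = phi 2 + k \/
   phi 2 = phi 3 + k /\ phi 1 = phi 2 + k + 1 \/
   phi 2 = phi 3 + k + 1 /\ phi 1 = phi 2 + k \/
   phi 2 = phi 3 + k + 1 /\ phi 1 = phi 2 + k + 1)%N by lia.
- by exists k, 0%N, 0%N; split=> //; lia.
- by exists k, 0%N, 1%N; split=> //; lia.
- by exists k, 1%N, 1%N; split=> //; lia.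
- by exists k.+1, 0%N, 0%N; split=> //; lia.
Qed.

Local Close Scope ring_scope.

Theorem theorem1p1 (K : fieldType) (phi : nat -> nat)
  (hphi : linear_degree_function phi \/ almost_linear_degree_function phi)
  (hchar : [pchar K]%R =i pred0 \/
     exists2 p : nat, p \in [pchar K]%R & phi 1 + phi 2 + phi 3 - 2 < p) :
  hilbert_series (I_ideal K phi) =1 hilbert_series (J_ideal K phi).
Proof.
have [phi3_gt0 [k [u [v phi_lin]]]] := near_linear_degree hphi.
have unitK := natr_unit_upto_pchar hchar.
move=> j; rewrite I_idealE hilbert_monomial_ideal J_idealE.
by apply/eqP; rewrite eqn_leq (hilbert_powers_ge phi3_gt0 phi_lin unitK)
  (hilbert_powers_le phi3_gt0 phi_lin unitK).
Qed.
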